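(* Let $n\ge 1$ be an integer and let $\lambda_0,\lambda_1,\lambda_2\in\mathbb{C}$ be such that all the zeros of $u(z)=\lambda_0+\binom{n}{1}\lambda_1 z+\binom{n}{2}\lambda_2 z^2$ lie in the half plane $\{z\in\mathbb{C}: |z|\le |z-\tfrac n2|\}$. Let $B$ be the associated operator on polynomials of degree at most $n$, $B[P(z)]=\lambda_0P(z)+\lambda_1\left(\frac{nz}{2}\right)\frac{P'(z)}{1!}+\lambda_2\left(\frac{nz}{2}\right)^2\frac{P''(z)}{2!}$. If $P(z)$ is a polynomial of degree $n$ with complex coefficients which does not vanish in $|z|<1$, then for all real or complex numbers $\alpha,\beta$ with $|\alpha|\le 1$, $|\beta|\le 1$, every real $R\ge 1$ and every $z\in\mathbb{C}$ with $|z|\ge 1$, $$\left|B[P(Rz)]-\alpha B[P(z)]+\beta\left\{\left(\frac{R+1}{2}\right)^n-|\alpha|\right\}B[P(z)]\right|$$ $$\le\frac12\left[\left|R^n-\alpha+\beta\left\{\left(\frac{R+1}{2}\right)^n-|\alpha|\right\}\right||B[z^n]|+\left|1-\alpha+\beta\left\{\left(\frac{R+1}{2}\right)^n-|\alpha|\right\}\right||\lambda_0|\right]\max_{|w|=1}|P(w)|.$$ Equality is attained for $P(z)=z^n+1$ (at some point $z$ with $|z|\ge 1$).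
   Context: $B$ is applied to polynomials in the variable $z$: $B[P(Rz)]$ denotes the result of applying $B$ to the polynomial $z\mapsto P(Rz)$, evaluated at $z$ (so derivatives are taken with respect to $z$), and $B[z^n]$ denotes $B$ applied to the monomial $z^n$, evaluated at $z$. The integer $n$ in the definition of $B$ is the same $n$ as the degree of $P$. *)

(* Defs.v *)
From mathcomp Require Export all_boot all_order all_algebra.
From mathcomp Require Export boolp classical_sets reals complex.

Set Implicit Arguments.
Unset Strict Implicit.
Unset Printing Implicit Defensive.

Import Order.TTheory GRing.Theory Num.Theory.

Local Open Scope ring_scope.
Local Open Scope complex_scope.
Local Open Scope classical_set_scope.

Definition upoly (R : realType) (n : nat) (lam0 lam1 lam2 : R[i]) :
    {poly R[i]} :=
  lam0%:P + ('C(n, 1)%:R * lam1) *: 'X + ('C(n, 2)%:R * lam2) *: 'X^2.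

Definition Bop (R : realType) (n : nat) (lam0 lam1 lam2 : R[i])
    (P : {poly R[i]}) : {poly R[i]} :=
  lam0 *: P
  + lam1 *: (((n%:R / 2) *: 'X) * ((1`!)%:R^-1 *: P^`()))
  + lam2 *: (((n%:R / 2) *: 'X) ^+ 2 * ((2`!)%:R^-1 *: P^`(2))).

(* The polynomial z |-> P(r z). *)
Definition dilate (R : realType) (r : R) (P : {poly R[i]}) : {poly R[i]} :=
  P \Po (r%:C *: 'X).

(* The maximum of |P| on the unit circle; it exists by compactness, so it is
   the supremum.  [normc w : R] is the modulus, `|w| = (normc w)%:C. *)
Definition max_circle (R : realType) (P : {poly R[i]}) : R :=
  sup [set Normc.normc P.[w] | w in [set w : R[i] | `|w| = 1]].

Definition beta_term (R : realType) (n : nat) (alpha beta : R[i]) (r : R) : R[i] :=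
  beta * ((((r + 1) / 2) ^+ n)%:C - `|alpha|).

(* Main.v *)
Require Import Defs.
From mathcomp Require Import ring lra zify cyclic separable cyclotomic.
Import Order.TTheory GRing.Theory Num.Theory.
Local Open Scope ring_scope.
Local Open Scope complex_scope.

Set Implicit Arguments.
Unset Strict Implicit.
Unset Printing Implicit Defensive.

Local Notation normc := Normc.normc.
Local Notation normcM := Normc.normcM.

(** The proof follows the classical route through zeros of polynomials, with
every analytic ingredient replaced by an elementary one.

Write gamma for - alpha + beta (((r + 1) / 2)^n - |alpha|), so that
|gamma| <= ((r + 1) / 2)^n, and L[P] for B applied to P(rz) + gamma P(z); the
claim bounds |L[P](z)|.

Zeros.  Let H have degree n and all its zeros in |w| <= 1.
For |z| > 1 and r > 1, comparing the factors rz - w and z - w gives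
|H(rz)| > ((r + 1) / 2)^n |H(z)| ([normc_dilate_gt]), so H(rz) + gamma H(z)
again has all its zeros in the closed disk ([dilate_comb_disk_roots]).  The
operator B preserves this property as well ([Bop_neq0]): splitting u into two
factors a - k y exhibits n (n - 1) B[H](z) as two successive polar derivatives
of H evaluated at z (for n = 1, B[H](z) is a single one).  The half plane
condition says exactly that, for |z| > 1, the poles lie outside the disk, so
that Laguerre's theorem ([laguerre]) applies at each step.  Hence L[H] has no zero in |z| > 1.

Comparison.  If |P| <= |F| outside the disk and F has degree n with all its
zeros in the disk, then so does P - c F for |c| > 1, whence
L[P](z) <> c L[F](z); therefore |L[P]| <= |L[F]| on |z| >= 1
([Bop_comb_comparison]).

Conclusion.  Let Q be the conjugate reversal of P.  As P has no zero in the open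
disk, |P| <= |Q| outside it, and |L[P]| <= |L[Q]| ([Bop_comb_recip]).  Let M
be the maximum of |P| on the circle.  For N > M and |c| = N, the maximum
modulus principle ([max_modulus]) shows that P - c has no zero in the disk, and
the previous inequality for P - c, with the argument of c chosen so that the
right-hand side is N |L[z^n]| - |L[Q]|, yields
|L[P]| + |L[Q]| <= N (|L[z^n]| + |L[1]|) ([Bop_comb_recip_sum]).  Let N tend
to M and average with |L[P]| <= |L[Q]|.

The degenerate case r^n + gamma = 0 forces r = 1 and gamma = - 1, and then
L = 0.  For P = z^n + 1, L[P](z) = A z^n + D with constants A and D, and a
point of the unit circle that aligns the two terms gives equality. *)

(** * The modulus on R[i], valued in R *)

Lemma normc_ge0 (R : rcfType) (x : R[i]) : 0 <= normc x.
Proof. by case: x => a b; exact: sqrtr_ge0. Qed.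

Lemma sqr_normcE (R : rcfType) (x : R[i]) :
  normc x ^+ 2 = complex.Re x ^+ 2 + complex.Im x ^+ 2.
Proof. by case: x => a b /=; rewrite sqr_sqrtr // addr_ge0 ?sqr_ge0. Qed.

Lemma ltr_normc_sqr (R : rcfType) (x y : R[i]) :
  (normc x < normc y) = (normc x ^+ 2 < normc y ^+ 2).
Proof. by rewrite ltr_pXn2r // nnegrE normc_ge0. Qed.

Lemma ler_normc_sqr (R : rcfType) (x y : R[i]) :
  (normc x <= normc y) = (normc x ^+ 2 <= normc y ^+ 2).
Proof. by rewrite ler_pXn2r // nnegrE normc_ge0. Qed.

Lemma normcX (R : rcfType) (x : R[i]) k : normc (x ^+ k) = normc x ^+ k.
Proof.
elim: k => [|k IHk]; first by rewrite !expr0 Normc.normc1.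
by rewrite !exprS normcM IHk.
Qed.

Lemma normc_conj (R : rcfType) (x : R[i]) : normc (conjc x) = normc x.
Proof. by case: x => a b /=; rewrite sqrrN. Qed.

Lemma normcC (R : rcfType) (x : R) : normc x%:C = `|x|.
Proof. by rewrite /= expr0n addr0 sqrtr_sqr. Qed.

Lemma normc_nat (R : rcfType) n : normc (n%:R : R[i]) = n%:R.
Proof. by rewrite -(rmorph_nat (real_complex R)) normcC ger0_norm ?ler0n. Qed.

Lemma normc_eq0 (R : rcfType) (x : R[i]) : (normc x == 0) = (x == 0).
Proof.
by apply/eqP/eqP => [/Normc.eq0_normc //|->]; rewrite Normc.normc0.
Qed.

Lemma normc_gt0 (R : rcfType) (x : R[i]) : (0 < normc x) = (x != 0).
Proof. by rewrite lt_def normc_ge0 normc_eq0 andbT. Qed.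

Lemma normcN (R : rcfType) (x : R[i]) : normc (- x) = normc x.
Proof. exact: normcN. Qed.

Lemma normc_tri (R : rcfType) (x y : R[i]) :
  normc (x + y) <= normc x + normc y.
Proof. exact: le_normcD. Qed.

Lemma normc_triB (R : rcfType) (x y : R[i]) :
  normc x - normc y <= normc (x - y).
Proof. by rewrite lerBlDr -{1}[x](subrK y) normc_tri. Qed.

Lemma normc_prod (R : rcfType) (I : Type) (s : seq I) (F : I -> R[i]) :
  normc (\prod_(i <- s) F i) = \prod_(i <- s) normc (F i).
Proof.
elim: s => [|i s IHs]; first by rewrite !big_nil Normc.normc1.
by rewrite !big_cons normcM IHs.
Qed.

Lemma normc_sum (R : rcfType) (I : Type) (s : seq I) (F : I -> R[i]) :
  normc (\sum_(i <- s) F i) <= \sum_(i <- s) normc (F i).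
Proof.
elim: s => [|i s IHs]; first by rewrite !big_nil Normc.normc0.
by rewrite !big_cons (le_trans (normc_tri _ _)) // lerD2l.
Qed.

(** The unit number v turns b into the direction of a.  The case t = 1 makes the
two terms add up, a negative t makes them subtract. *)
Lemma unit_align (R : rcfType) (a b : R[i]) :
  exists2 v, normc v = 1 &
    forall t : R, normc (a + t%:C * (v * b)) = `|normc a + t * normc b|.
Proof.
have [->|a0] := eqVneq a 0.
  exists 1 => [|t]; first exact: Normc.normc1.
  by rewrite mul1r Normc.normc0 !add0r normcM normcC normrM (ger0_norm (normc_ge0 b)).
have [->|b0] := eqVneq b 0.
  exists 1 => [|t]; first exact: Normc.normc1.
  by rewrite mul1r Normc.normc0 !mulr0 !addr0 (ger0_norm (normc_ge0 a)).
have na := a0; have nb := b0; rewrite -normc_gt0 in na; rewrite -normc_gt0 in nb.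
have na' := lt0r_neq0 na; have nb' := lt0r_neq0 nb.
exists (a / b * (normc b / normc a)%:C) => [|t].
  rewrite !normcM normcC Normc.normcV gtr0_norm ?divr_gt0 //.
  by field; rewrite na' nb'.
have -> : a + t%:C * (a / b * (normc b / normc a)%:C * b) =
    a * (1 + t * (normc b / normc a))%:C.
  by rewrite rmorphD rmorphM rmorph1; field; rewrite fmorph_eq0 na' b0.
rewrite (normcM a) normcC -{1}[normc a](gtr0_norm na) -normrM; congr Num.norm.
by field.
Qed.

(** * Dilating a polynomial whose zeros lie in the unit disk *)

Definition disk_roots (R : rcfType) (p : {poly R[i]}) : Prop :=
  forall w, root p w -> normc w <= 1.

Lemma disk_roots_factor (R : rcfType) (p : {poly R[i]}) : p != 0 -> disk_roots p ->
  exists2 s : seq R[i], p = lead_coef p *: \prod_(w <- s) ('X - w%:P)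
    & {in s, forall w, normc w <= 1}.
Proof.
move=> p0 pD; have [s ps] := closed_field_poly_normal p.
exists s => // w ws; apply: pD.
by rewrite ps rootZ ?lead_coef_eq0 // root_prod_XsubC.
Qed.

Lemma size_factor (R : rcfType) (p : {poly R[i]}) (s : seq R[i]) n :
  size p = n.+1 -> p = lead_coef p *: \prod_(w <- s) ('X - w%:P) -> size s = n.
Proof.
move=> sp ps; have p0 : lead_coef p != 0.
  by rewrite lead_coef_eq0 -size_poly_eq0 sp.
by move: sp; rewrite ps size_scale // size_prod_XsubC => -[].
Qed.

(** Up to the factor (r - 1) / 4, the difference of the squares is a multiple of
|z + w|^2 plus a multiple of |z|^2 - |w|^2. *)
Lemma normc_dilate_factor (R : rcfType) (r : R) (z w : R[i]) :
  1 < r -> 1 < normc z -> normc w <= 1 ->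
  (r + 1) / 2 * normc (z - w) < normc (r%:C * z - w).
Proof.
move=> r1 z1 w1.
have r0 : 0 <= (r + 1) / 2 by lra.
rewrite -[X in X * _](ger0_norm r0) -normcC -normcM ltr_normc_sqr normcM.
rewrite exprMn normcC ger0_norm // !sqr_normcE.
have wz : normc w ^+ 2 < normc z ^+ 2 by rewrite -ltr_normc_sqr; lra.
move: wz; rewrite !sqr_normcE; case: z w {z1 w1} => a b [c d] /= wz.
rewrite -subr_gt0.
set t := (X in 0 < X).
have -> : t = (r - 1) / 4 * ((r - 1) * ((a + c) ^+ 2 + (b + d) ^+ 2)
          + (2 * r + 2) * (a ^+ 2 + b ^+ 2 - (c ^+ 2 + d ^+ 2))).
  by rewrite /t; field.
apply: mulr_gt0; first lra.
apply: ltr_wpDl.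
  by apply: mulr_ge0; [lra | rewrite addr_ge0 ?sqr_ge0].
by apply: mulr_gt0; lra.
Qed.

Lemma normc_dilate_gt (R : rcfType) (n : nat) (p : {poly R[i]}) (r : R) (z : R[i]) :
  size p = n.+1 -> (0 < n)%N -> disk_roots p -> 1 < r -> 1 < normc z ->
  ((r + 1) / 2) ^+ n * normc p.[z] < normc p.[r%:C * z].
Proof.
move=> sp n0 pD r1 z1.
have p0 : p != 0 by rewrite -size_poly_eq0 sp.
have [s ps sD] := disk_roots_factor p0 pD.
have <- := size_factor sp ps; have sn := size_factor sp ps.
rewrite ps !hornerZ !normcM mulrCA ltr_pM2l ?normc_gt0 ?lead_coef_eq0 //.
have -> (x : R[i]) (t : R) : t ^+ size s *
    normc (\prod_(w <- s) ('X - w%:P)).[x] = \prod_(w <- s) (t * normc (x - w)).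
  rewrite horner_prod normc_prod big_split /= big_const_seq count_predT.
  by rewrite iter_mulr_1; congr (_ * _); apply: eq_bigr => w _; rewrite hornerXsubC.
rewrite horner_prod normc_prod.
under [X in _ < X]eq_bigr => w _ do rewrite hornerXsubC.
rewrite big_seq [X in _ < X]big_seq; apply: ltr_prod => [|w ws].
  by apply/hasP; case: s {ps sD} sn n0 => [<-//|w s _ _]; exists w; rewrite ?mem_head.
by rewrite normc_dilate_factor ?sD // andbT mulr_ge0 ?normc_ge0 //; lra.
Qed.

(** * Laguerre's theorem on polar derivatives *)

(** The Moebius map w |-> (q - a w) / (x - w) sends the unit disk to a convex set:
solving for w, the bound |w| <= 1 becomes |v x - q| <= |v - a|, that is
2 Re (kappa v) >= |q|^2 - |a|^2 + |v|^2 (|x|^2 - 1) with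
kappa = x q^* - a^*.  So the image lies in an open half plane bounded by a line
through 0, and sums of image points do not vanish. *)
Lemma laguerre_factor (R : rcfType) (a q x w : R[i]) :
  normc a < normc q -> 1 < normc x -> normc w <= 1 ->
  0 < complex.Re ((x * conjc q - conjc a) * ((q - a * w) / (x - w))).
Proof.
move=> aq x1 w1.
have xw : x - w != 0 by rewrite subr_eq0; apply: contraTneq x1 => ->; rewrite -leNgt.
set v := (q - a * w) / (x - w).
have vE : v * (x - w) = q - a * w by rewrite /v divfK.
clearbody v.
have wE : w * (v - a) = v * x - q.
  apply/eqP; rewrite -subr_eq0; apply/eqP.
  by transitivity (q - a * w - v * (x - w)); [ring | rewrite vE subrr].
have h : normc (v * x - q) <= normc (v - a).
  by rewrite -wE normcM ler_piMl ?normc_ge0.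
have v0 : 0 <= normc v ^+ 2 * (normc x ^+ 2 - 1).
  by rewrite mulr_ge0 ?sqr_ge0 // subr_ge0 expr_ge1 ?normc_ge0 // ltW.
move: h aq v0; rewrite ler_normc_sqr ltr_normc_sqr !sqr_normcE.
case: v x a q {vE xw wE x1} => v1 v2 [x1 x2] [a1 a2] [q1 q2] /=.
by lra.
Qed.

(** The polar derivative of p, of formal degree m, with respect to the pole q / a.
The homogeneous form includes the ordinary derivative, whose pole is at
infinity (a = 0). *)
Definition polar (R : rcfType) (m : nat) (a q : R[i]) (p : {poly R[i]}) : {poly R[i]} :=
  a *: (m%:R *: p - 'X * p^`()) + q *: p^`().

Lemma horner_polar (R : rcfType) m (a q : R[i]) p x :
  (polar m a q p).[x] = a * (m%:R * p.[x] - x * p^`().[x]) + q * p^`().[x].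
Proof. by rewrite /polar !hornerE. Qed.

Lemma coef_polar (R : rcfType) m (a q : R[i]) p i :
  (polar m a q p)`_i = a * (m%:R - i%:R) * p`_i + q * i.+1%:R * p`_i.+1.
Proof.
rewrite /polar coefD !coefZ coefB coefZ coefXM !coef_deriv -[in RHS]mulrA.
by case: i => [|i] /=; ring.
Qed.

Lemma polarZ (R : rcfType) m (a q c : R[i]) p :
  polar m a q (c *: p) = c *: polar m a q p.
Proof. by apply/polyP => i; rewrite coefZ !coef_polar !coefZ; ring. Qed.

(** The identity m - x p'(x) / p(x) = - sum_w w / (x - w) turns the polar
derivative into a sum over the zeros of p. *)
Lemma polar_logderiv (R : rcfType) (a q x : R[i]) (s : seq R[i]) :
  {in s, forall w, x - w != 0} ->
  (polar (size s) a q (\prod_(w <- s) ('X - w%:P))).[x] =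
  (\prod_(w <- s) ('X - w%:P)).[x] * \sum_(w <- s) (q - a * w) / (x - w).
Proof.
rewrite horner_polar; elim: s => [|w s IHs] sx.
  by rewrite !big_nil /= derivC !hornerE; ring.
have /IHs {}IHs : {in s, forall w, x - w != 0} by move=> v vs; rewrite sx // inE vs orbT.
have xw : x - w != 0 by rewrite sx ?mem_head.
rewrite !big_cons derivM derivXsubC mul1r.
rewrite !(hornerXsubC, hornerM, hornerD _ (_ * _)) [size _]/=.
move: IHs; set P := (\prod_(v <- s) _).[x]; set S := \sum_(v <- s) _ => IHs.
have -> : (x - w) * P * ((q - a * w) / (x - w) + S) = P * (q - a * w) + (x - w) * (P * S).
  by field.
by rewrite -IHs -natr1; ring.
Qed.

(** Outside the disk the polar derivative is p times a sum of points of one open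
half plane.  The degree is exact because the coefficient of degree m is
(q (m + 1) - a S) times the leading one, where S, the sum of the m + 1 zeros,
has modulus at most m + 1. *)
Lemma laguerre (R : rcfType) (m : nat) (a q : R[i]) (p : {poly R[i]}) :
  size p = m.+2 -> disk_roots p -> normc a < normc q ->
  size (polar m.+1 a q p) = m.+1 /\ disk_roots (polar m.+1 a q p).
Proof.
move=> sp pD aq; have p0 : p != 0 by rewrite -size_poly_eq0 sp.
have [s ps sD] := disk_roots_factor p0 pD; have sm := size_factor sp ps.
have c0 : lead_coef p != 0 by rewrite lead_coef_eq0.
split.
  apply/eqP; rewrite eqn_leq; apply/andP; split.
    apply/leq_sizeP => j mj; rewrite coef_polar.
    rewrite [p`_j.+1]nth_default ?sp // mulr0 addr0.
    move: mj; rewrite leq_eqVlt => /predU1P[<-|mj]; first by ring.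
    by rewrite nth_default ?sp // mulr0.
  rewrite ltnNge; apply/negP => /leq_sizeP/(_ m (leqnn m)).
  rewrite coef_polar -natr1 [m%:R + 1 - _]addrAC subrr add0r mulr1.
  have -> : p`_m.+1 = lead_coef p by rewrite lead_coefE sp.
  have -> : p`_m = lead_coef p * - \sum_(w <- s) w.
    by rewrite {1}ps coefZ -coefPn_prod_XsubC ?sm.
  set S := \sum_(w <- s) w => h.
  have {}h : q * m.+1%:R = a * S.
    by apply: (mulfI c0); apply/eqP; rewrite -subr_eq0 -h; apply/eqP; ring.
  have hs : normc S <= m.+1%:R.
    rewrite (le_trans (normc_sum _ _)) // -sm -sum1_size natr_sum.
    by rewrite big_seq [leRHS]big_seq ler_sum.
  have : normc q * m.+1%:R <= normc a * m.+1%:R.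
    have {1}-> : m.+1%:R = normc (m.+1%:R : R[i]).
      by rewrite normc_nat.
    by rewrite -normcM h normcM ler_wpM2l ?normc_ge0.
  by rewrite ler_pM2r ?ltr0Sn // leNgt aq.
move=> x; apply: contraTT; rewrite -ltNge => x1.
have sx : {in s, forall w, x - w != 0}.
  by move=> w /sD w1; rewrite subr_eq0; apply: contraTneq x1 => ->; rewrite -leNgt.
rewrite rootE ps -sm polarZ hornerZ polar_logderiv // !mulf_neq0 //.
  rewrite horner_prod prodf_seq_neq0; apply/allP => w /sx.
  by rewrite hornerXsubC.
set S := \sum_(w <- s) _.
suff : 0 < complex.Re ((x * conjc q - conjc a) * S).
  by apply: contraTneq => ->; rewrite mulr0 ltxx.
rewrite /S mulr_sumr.
have : (0 < size s)%N by rewrite sm.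
elim: (s) sD => // w t IHt tD _; rewrite big_cons raddfD /=.
have hw : 0 < complex.Re ((x * conjc q - conjc a) * ((q - a * w) / (x - w))).
  by rewrite laguerre_factor // tD ?mem_head.
case: t IHt tD => [|v t] IHt tD; first by rewrite big_nil addr0.
rewrite addr_gt0 // IHt // => u ut; apply: tD; by rewrite inE ut orbT.
Qed.

(** * The operator B preserves polynomials with zeros in the disk *)

Definition half_plane_zeros (R : rcfType) (n : nat) (u : R[i] -> R[i]) : Prop :=
  forall y, u y = 0 -> normc y <= normc (y - n%:R / 2).

(** A linear factor a - k y of u corresponds to a polar derivative at z with pole
q / a, where q = z (a - k n / 2).  The half plane condition at y = a / k reads
|a| <= |a - k n / 2|, which places this pole outside the disk.  The zero factor
(a = k = 0) is excluded because n / 2 is not in the half plane. *)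
Lemma half_plane_pole (R : rcfType) (n : nat) (a k z : R[i]) :
  (0 < n)%N -> half_plane_zeros n (fun y => a - k * y) -> 1 < normc z ->
  normc a < normc (a * z - k * (n%:R / 2 * z)).
Proof.
move=> n0 hp z1; have h0 : (n%:R / 2 : R[i]) != 0.
  by rewrite mulf_neq0 ?invr_neq0 ?pnatr_eq0 // -lt0n.
have nhalf : ~ normc (n%:R / 2 : R[i]) <= normc (n%:R / 2 - n%:R / 2 : R[i]).
  by rewrite subrr Normc.normc0 leNgt normc_gt0 h0.
have [k0|k0] := eqVneq k 0.
  rewrite k0 mul0r subr0 normcM ltr_pMr // normc_gt0; apply/eqP => a0.
  by apply: nhalf; apply: hp; rewrite a0 k0; ring.
have /hp hy : a - k * (a / k) = 0 by field.
have -> : a * z - k * (n%:R / 2 * z) = k * z * (a / k - n%:R / 2) by field.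
have -> : normc a = normc k * normc (a / k) by rewrite -normcM; congr normc; field.
rewrite !normcM -mulrA ltr_pM2l ?normc_gt0 // -normcM.
apply: (le_lt_trans hy); rewrite ltr_pMl // normc_gt0 subr_eq0.
by apply/eqP => e; apply: nhalf; rewrite -{1 2}e.
Qed.

(** The homogeneous factors a - k y and b - l y cover degree less than two, a root
at infinity being k = 0. *)
Lemma quadratic_split (R : rcfType) (c0 c1 c2 : R[i]) :
  exists a k b l, [/\ c0 = a * b, c1 = - (a * l + b * k) & c2 = k * l :> R[i]].
Proof.
have [->|h2] := eqVneq c2 0.
  by exists c0, (- c1), 1, 0; split; ring.
pose d := sqrtC (c1 ^+ 2 - 4 * c0 * c2).
have dE : d ^+ 2 = c1 ^+ 2 - 4 * c0 * c2 by rewrite /d sqrtCK.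
exists ((d - c1) / 2), c2, (- (c1 + d) / (2 * c2)), 1; split; try by field.
transitivity ((c1 ^+ 2 - d ^+ 2) / (4 * c2)); last by field.
by rewrite dE; field.
Qed.

Lemma horner_Bop (R : realType) n (lam0 lam1 lam2 : R[i]) P z :
  (Bop n lam0 lam1 lam2 P).[z] =
  lam0 * P.[z] + lam1 * (n%:R / 2 * z * P^`().[z])
  + lam2 * ((n%:R / 2 * z) ^+ 2 * (2^-1 * P^`()^`().[z])).
Proof.
rewrite /Bop !(hornerD, hornerZ, hornerM, horner_exp, hornerX) /=.
by rewrite factS fact0 invr1 mul1r.
Qed.

Lemma horner_BopZ (R : realType) n (lam0 lam1 lam2 : R[i]) c p z :
  (Bop n lam0 lam1 lam2 (c *: p)).[z] = c * (Bop n lam0 lam1 lam2 p).[z].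
Proof. by rewrite !horner_Bop !(derivZ, hornerZ); ring. Qed.

Lemma Bop_1 (R : realType) n (lam0 lam1 lam2 : R[i]) z :
  (Bop n lam0 lam1 lam2 1).[z] = lam0.
Proof. by rewrite horner_Bop -polyC1 derivC deriv0 !hornerC; ring. Qed.

Lemma Bop_Xn (R : realType) n (lam0 lam1 lam2 : R[i]) m :
  exists c, forall z, (Bop n lam0 lam1 lam2 'X^m).[z] = c * z ^+ m.
Proof.
exists (lam0 + lam1 * (n%:R / 2 * m%:R)
        + lam2 * ((n%:R / 2) ^+ 2 * (2^-1 * (m%:R * m.-1%:R)))) => z.
rewrite horner_Bop derivXn derivMn derivXn !(hornerMn, hornerXn).
case: m => [|[|m]] /=; rewrite ?expr0 ?expr1 ?exprS; ring.
Qed.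

(** Evaluated at z, n (n - 1) B[H] is the polar derivative of a polar derivative of
H, one for each factor of u. *)
Lemma Bop_neq0 (R : realType) (n : nat) (lam0 lam1 lam2 : R[i]) (H : {poly R[i]}) z :
  (0 < n)%N ->
  half_plane_zeros n (horner (upoly n lam0 lam1 lam2)) ->
  size H = n.+1 -> disk_roots H -> 1 < normc z ->
  (Bop n lam0 lam1 lam2 H).[z] != 0.
Proof.
move=> n0 hu sH HD z1.
have uE y : (upoly n lam0 lam1 lam2).[y] =
    lam0 + 'C(n, 1)%:R * lam1 * y + 'C(n, 2)%:R * lam2 * y ^+ 2.
  by rewrite /upoly !hornerE.
have nz (p : {poly R[i]}) : disk_roots p -> p.[z] != 0.
  by move=> pD; apply/negP => /pD; rewrite leNgt z1.
case: n n0 hu sH uE => [//|[|m]] _ hu sH uE.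
  (* n = 1: u is itself a linear factor, and B[H] is one polar derivative. *)
  have q1 : normc lam0 < normc (lam0 * z - (- lam1) * (1%:R / 2 * z)).
    apply: half_plane_pole => // y; rewrite mulNr opprK => y0; apply: hu.
    by rewrite uE binn bin_small // mulr1n mul1r mulr0n !mul0r addr0.
  have [_ d1] := laguerre sH HD q1.
  have := nz _ d1; apply: contraNneq; rewrite horner_polar horner_Bop => e.
  have H2 : H^`()^`() = 0.
    apply/size_poly_leq0P; apply/leq_sizeP => j _.
    by rewrite !coef_deriv nth_default ?mul0rn // sH.
  by apply/eqP; apply: etrans e; rewrite H2 horner0; field.
(* n >= 2: one polar derivative for each of the two factors of u. *)
have [a [k [b [l [e0 e1 e2]]]]] :=
  quadratic_split lam0 ('C(m.+2, 1)%:R * lam1) ('C(m.+2, 2)%:R * lam2).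
have uf y : (upoly m.+2 lam0 lam1 lam2).[y] = (a - k * y) * (b - l * y).
  by rewrite uE e0 e1 e2; ring.
have q1 : normc a < normc (a * z - k * (m.+2%:R / 2 * z)).
  by apply: half_plane_pole => // y y0; apply: hu; rewrite uf y0 mul0r.
have q2 : normc b < normc (b * z - l * (m.+2%:R / 2 * z)).
  by apply: half_plane_pole => // y y0; apply: hu; rewrite uf y0 mulr0.
have [s1 d1] := laguerre sH HD q1.
have [_ d2] := laguerre s1 d1 q2.
have := nz _ d2; apply: contraNneq.
rewrite horner_Bop horner_polar /polar !(derivD, derivN, derivZ, derivM, derivX) mul1r.
rewrite !(hornerD, hornerZ, hornerN, hornerM, hornerX) => e.
have e1' : m.+2%:R * lam1 = - (a * l + b * k) by rewrite -e1 bin1.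
have e2' : m.+2%:R * m.+1%:R * lam2 = 2 * (k * l).
  have := mul_bin_diag m.+2 1; rewrite bin1 /= => /(congr1 (fun k => k%:R : R[i])).
  by rewrite !natrM -e2 => ->; ring.
apply/eqP; transitivity (m.+2%:R * m.+1%:R * 0 : R[i]); last by rewrite mulr0.
rewrite -e; move: H.[z] H^`().[z] H^`()^`().[z] => h0 h1 h2 in e1' e2' *.
transitivity (m.+2%:R * m.+1%:R * (a * b) * h0
  + m.+1%:R * (m.+2%:R * lam1) * (m.+2%:R / 2 * z * h1)
  + (m.+2%:R * m.+1%:R * lam2) * ((m.+2%:R / 2 * z) ^+ 2 * (2^-1 * h2)));
  last by rewrite e0; ring.
by rewrite e1' e2' -!natr1; field.
Qed.

(** * Limits of inequalities between moduli, and the conjugate reversal *)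

Lemma horner_lipschitz (R : rcfType) (p : {poly R[i]}) (rho : R) : 0 <= rho ->
  exists2 C, 0 <= C & forall x y, normc x <= rho -> normc y <= rho ->
    normc p.[x] <= C /\ normc (p.[x] - p.[y]) <= C * normc (x - y).
Proof.
move=> rho0; elim/poly_ind: p => [|p c [C C0 IHC]].
  by exists 0 => // x y _ _; rewrite !horner0 subrr Normc.normc0 mul0r.
exists (C + C * rho + normc c) => [|x y xr yr].
  by rewrite !addr_ge0 ?mulr_ge0 ?normc_ge0.
have [px pxy] := IHC x y xr yr; rewrite !hornerMXaddC.
have n0 := @normc_ge0 R; split.
  apply: (le_trans (normc_tri _ _)); rewrite lerD2r normcM.
  by rewrite (le_trans (ler_pM _ _ px xr)) ?n0 // lerDr.
have -> : p.[x] * x + c - (p.[y] * y + c) = p.[x] * (x - y) + y * (p.[x] - p.[y]).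
  by ring.
apply: (le_trans (normc_tri _ _)); rewrite !normcM !mulrDl -addrA lerD //.
  by rewrite ler_wpM2r.
apply: ler_wpDr; first by rewrite mulr_ge0.
by rewrite [C * rho]mulrC -mulrA ler_pM.
Qed.

(** Serves twice: to pass from |z| > 1 to |z| = 1, and to read the value at
infinity as the value of a reversed polynomial at 0. *)
Lemma horner_norm_le_limit (R : rcfType) (p q : {poly R[i]}) x :
  (forall e : R, 0 < e -> exists2 y, normc (y - x) < e & normc p.[y] <= normc q.[y]) ->
  normc p.[x] <= normc q.[x].
Proof.
move=> h; rewrite leNgt; apply/negP => lt_qp.
set d := normc p.[x] - normc q.[x]; have d0 : 0 < d by rewrite subr_gt0.
have r0 : 0 <= normc x + 1 by rewrite addr_ge0 ?normc_ge0.
have [C C0 hC] := horner_lipschitz p r0; have [D D0 hD] := horner_lipschitz q r0.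
have s0 : 0 < C + D + d + 1 by lra.
have [y] := h (d / (C + D + d + 1)) (divr_gt0 d0 s0).
rewrite ltr_pdivlMr // => ye pq.
have t0 := normc_ge0 (y - x).
have y1 : normc (y - x) < 1 by nra.
have yr : normc y <= normc x + 1.
  by rewrite -[y](subrK x) (le_trans (normc_tri _ _)) // addrC lerD2l ltW.
have xr : normc x <= normc x + 1 by lra.
have xy : normc (x - y) = normc (y - x) by rewrite -[in LHS]normcN opprB.
have [_] := hC x y xr yr; rewrite xy; have [_] := hD y x yr xr.
have := normc_triB q.[y] q.[x].
have := normc_triB p.[x] p.[y].
move: ye pq t0 C0 D0 d0; rewrite /d; nra.
Qed.

(** For p of degree at most n this is z^n (p (1 / z^* ))^*, whose modulus on the
unit circle is that of p. *)
Definition recip (R : rcfType) (n : nat) (p : {poly R[i]}) : {poly R[i]} :=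
  \poly_(i < n.+1) conjc p`_(n - i).

Lemma horner_recip (R : rcfType) n (p : {poly R[i]}) x :
  (size p <= n.+1)%N -> x != 0 ->
  (recip n p).[x] = x ^+ n * conjc p.[(conjc x)^-1].
Proof.
move=> sp x0; rewrite /recip horner_poly (horner_coef_wide _ sp) rmorph_sum mulr_sumr.
rewrite (reindex_inj rev_ord_inj); apply: eq_bigr => i _ /=.
have ni : (i <= n)%N by rewrite -ltnS.
rewrite subSS subKn // rmorphM rmorphXn /= fmorphV /= conjcK mulrCA; congr (_ * _).
by rewrite exprVn -[in x ^+ n](subnK ni) exprD mulfK ?expf_neq0.
Qed.

Lemma coef0_recip (R : rcfType) n (p : {poly R[i]}) : (recip n p).[0] = conjc p`_n.
Proof. by rewrite horner_coef0 coef_poly subn0. Qed.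

Lemma recip_subC (R : rcfType) n (p : {poly R[i]}) c :
  recip n (p - c *: 1) = recip n p - conjc c *: 'X^n.
Proof.
apply/polyP => j; rewrite /recip coefB coefZ !coef_poly coefXn coefB coefZ coef1.
rewrite subn_eq0 ltnS; have [jn|nj] := leqP j n.
  rewrite rmorphB rmorphM rmorph_nat eqn_leq jn /=; congr (_ - _ * _%:R).
by rewrite gtn_eqF // mulr0 subrr.
Qed.

(** Comparison of p and q at infinity: the coefficients of degree n are, up to
conjugation, the values at 0 of the conjugate reversals. *)
Lemma normc_coef_le (R : rcfType) n (p q : {poly R[i]}) :
  (size p <= n.+1)%N -> (size q <= n.+1)%N ->
  (forall x, 1 < normc x -> normc p.[x] <= normc q.[x]) ->
  normc p`_n <= normc q`_n.
Proof.
move=> sp sq pq; rewrite -(normc_conj p`_n) -(normc_conj q`_n) -!coef0_recip.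
apply: horner_norm_le_limit => e e0.
have t0 : 0 < e / (1 + e) by rewrite divr_gt0 //; lra.
have t1 : e / (1 + e) < 1 by rewrite ltr_pdivrMr; lra.
have te : e / (1 + e) < e by rewrite ltr_pdivrMr; nra.
exists (e / (1 + e))%:C; first by rewrite subr0 normcC gtr0_norm.
have y0 : (e / (1 + e))%:C != 0 :> R[i] by rewrite -normc_gt0 normcC gtr0_norm.
rewrite !horner_recip // !normcM ler_wpM2l ?normc_ge0 // !normc_conj pq //.
by rewrite Normc.normcV normc_conj normcC gtr0_norm // invf_gt1.
Qed.

(** * The operator P(z) |-> B[P(rz)] + g B[P(z)] *)

Lemma coef_dilate (R : realType) (r : R) (p : {poly R[i]}) i :
  (dilate r p)`_i = (r ^+ i)%:C * p`_i.
Proof.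
rewrite /dilate comp_polyE.
under eq_bigr => j _ do rewrite exprZn scalerA.
rewrite -(poly_def (size p) (fun j => p`_j * r%:C ^+ j)) coef_poly rmorphXn mulrC.
by case: ltnP => // /(nth_default 0) ->; rewrite mulr0.
Qed.

Lemma horner_dilate (R : realType) (r : R) (p : {poly R[i]}) z :
  (dilate r p).[z] = p.[r%:C * z].
Proof. by rewrite /dilate horner_comp hornerZ hornerX. Qed.

Definition dilate_comb (R : realType) (r : R) (g : R[i]) (p : {poly R[i]}) : {poly R[i]} :=
  dilate r p + g *: p.

Lemma coef_dilate_comb (R : realType) (r : R) (g : R[i]) p i :
  (dilate_comb r g p)`_i = ((r ^+ i)%:C + g) * p`_i.
Proof. by rewrite /dilate_comb coefD coefZ coef_dilate mulrDl. Qed.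

(** At a zero x with |x| > 1 one would have |p(rx)| = |g| |p(x)|, which the strict
growth of p forbids when r > 1; for r = 1 the combination is (1 + g) p. *)
Lemma dilate_comb_disk_roots (R : realType) n (r : R) (g : R[i]) (p : {poly R[i]}) :
  (0 < n)%N -> 1 <= r -> normc g <= ((r + 1) / 2) ^+ n -> (r ^+ n)%:C + g != 0 ->
  size p = n.+1 -> disk_roots p ->
  size (dilate_comb r g p) = n.+1 /\ disk_roots (dilate_comb r g p).
Proof.
move=> n0 r1 gK g0 sp pD; split.
  apply/eqP; rewrite eqn_leq; apply/andP; split.
    by apply/leq_sizeP => j nj; rewrite coef_dilate_comb nth_default ?sp ?mulr0.
  rewrite ltnNge; apply/negP => /leq_sizeP/(_ n (leqnn n))/eqP.
  rewrite coef_dilate_comb mulf_eq0 (negPf g0) /= => /eqP pn.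
  have : lead_coef p != 0 by rewrite lead_coef_eq0 -size_poly_eq0 sp.
  by rewrite lead_coefE sp pn eqxx.
move=> x; rewrite rootE /dilate_comb hornerD hornerZ horner_dilate => /eqP e.
rewrite leNgt; apply/negP => x1.
have px : p.[x] != 0 by apply/negP => /pD; rewrite leNgt x1.
move: r1; rewrite le_eqVlt => /predU1P[r1|r1].
  move: e g0; rewrite -r1 expr1n mul1r -{1}[p.[x]]mul1r -mulrDl => /eqP.
  by rewrite mulf_eq0 (negPf px) orbF => ->.
have := normc_dilate_gt sp n0 pD r1 x1.
have -> : p.[r%:C * x] = - (g * p.[x]) by apply/eqP; rewrite -addr_eq0 e.
by rewrite normcN normcM ltNge ler_wpM2r ?normc_ge0.
Qed.

Definition Bop_comb (R : realType) n (lam0 lam1 lam2 : R[i]) (r : R) (g : R[i])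
    (p : {poly R[i]}) : {poly R[i]} :=
  Bop n lam0 lam1 lam2 (dilate_comb r g p).

Lemma horner_Bop_comb (R : realType) n (lam0 lam1 lam2 : R[i]) (r : R) (g : R[i])
    (p : {poly R[i]}) z :
  (Bop_comb n lam0 lam1 lam2 r g p).[z] =
  (Bop n lam0 lam1 lam2 (dilate r p)).[z] + g * (Bop n lam0 lam1 lam2 p).[z].
Proof.
rewrite /Bop_comb /dilate_comb !horner_Bop !(derivD, derivZ) !(hornerD, hornerZ); ring.
Qed.

Lemma horner_Bop_combB (R : realType) n (lam0 lam1 lam2 : R[i]) (r : R) (g : R[i])
    (p q : {poly R[i]}) c z :
  (Bop_comb n lam0 lam1 lam2 r g (p - c *: q)).[z] =
  (Bop_comb n lam0 lam1 lam2 r g p).[z] - c * (Bop_comb n lam0 lam1 lam2 r g q).[z].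
Proof.
have -> : Bop_comb n lam0 lam1 lam2 r g (p - c *: q) =
    Bop n lam0 lam1 lam2 (dilate_comb r g p - c *: dilate_comb r g q).
  by congr Bop; apply/polyP => i; rewrite !(coefB, coefZ, coef_dilate_comb); ring.
rewrite /Bop_comb !horner_Bop !(derivD, derivN, derivZ) !(hornerD, hornerN, hornerZ); ring.
Qed.

Lemma horner_Bop_combZ (R : realType) n (lam0 lam1 lam2 : R[i]) (r : R) (g : R[i])
    (p : {poly R[i]}) c z :
  (Bop_comb n lam0 lam1 lam2 r g (c *: p)).[z] = c * (Bop_comb n lam0 lam1 lam2 r g p).[z].
Proof.
have -> : c *: p = p - (1 - c) *: p by rewrite scalerBl scale1r opprB addrC subrK.
by rewrite horner_Bop_combB; ring.
Qed.

Lemma horner_Bop_comb_Xn (R : realType) n (lam0 lam1 lam2 : R[i]) (r : R) (g : R[i]) m z :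
  (Bop_comb n lam0 lam1 lam2 r g 'X^m).[z] =
  ((r ^+ m)%:C + g) * (Bop n lam0 lam1 lam2 'X^m).[z].
Proof.
rewrite /Bop_comb -horner_BopZ; congr (Bop _ _ _ _ _).[z].
apply/polyP => i; rewrite coef_dilate_comb coefZ coefXn.
by case: eqP => [->|_]; rewrite ?mulr0.
Qed.

Lemma Bop_comb_neq0 (R : realType) n (lam0 lam1 lam2 : R[i]) (r : R) (g : R[i])
    (p : {poly R[i]}) z :
  (0 < n)%N -> half_plane_zeros n (horner (upoly n lam0 lam1 lam2)) ->
  1 <= r -> normc g <= ((r + 1) / 2) ^+ n -> (r ^+ n)%:C + g != 0 ->
  size p = n.+1 -> disk_roots p -> 1 < normc z ->
  (Bop_comb n lam0 lam1 lam2 r g p).[z] != 0.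
Proof.
move=> n0 hu r1 gK g0 sp pD z1.
by have [s d] := dilate_comb_disk_roots n0 r1 gK g0 sp pD; exact: Bop_neq0.
Qed.

(** If |L[p](y)| > |L[f](y)| and c is the quotient of these values, then p - c f has
degree n and all its zeros in the disk because |c| > 1, although L[p - c f]
vanishes at y. *)
Lemma Bop_comb_comparison (R : realType) n (lam0 lam1 lam2 : R[i]) (r : R) (g : R[i])
    (p f : {poly R[i]}) z :
  (0 < n)%N -> half_plane_zeros n (horner (upoly n lam0 lam1 lam2)) ->
  1 <= r -> normc g <= ((r + 1) / 2) ^+ n -> (r ^+ n)%:C + g != 0 ->
  size f = n.+1 -> disk_roots f -> (size p <= n.+1)%N ->
  (forall x, 1 < normc x -> normc p.[x] <= normc f.[x]) ->
  1 <= normc z ->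
  normc (Bop_comb n lam0 lam1 lam2 r g p).[z] <= normc (Bop_comb n lam0 lam1 lam2 r g f).[z].
Proof.
move=> n0 hu r1 gK g0 sf fD sp pf.
have out x : 1 < normc x -> f.[x] != 0.
  by move=> x1; apply/negP => /fD; rewrite leNgt x1.
have strict y : 1 < normc y -> normc (Bop_comb n lam0 lam1 lam2 r g p).[y] <=
    normc (Bop_comb n lam0 lam1 lam2 r g f).[y].
  move=> y1; rewrite leNgt; apply/negP => lt_fp.
  have f0 : (Bop_comb n lam0 lam1 lam2 r g f).[y] != 0 by apply: Bop_comb_neq0.
  pose c := (Bop_comb n lam0 lam1 lam2 r g p).[y] / (Bop_comb n lam0 lam1 lam2 r g f).[y].
  have c1 : 1 < normc c by rewrite normcM Normc.normcV ltr_pdivlMr ?normc_gt0 ?mul1r.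
  have : (Bop_comb n lam0 lam1 lam2 r g (p - c *: f)).[y] != 0.
    apply: Bop_comb_neq0 => //.
      apply/eqP; rewrite eqn_leq; apply/andP; split.
        apply/leq_sizeP => j nj; rewrite coefB coefZ !nth_default ?sf ?mulr0 ?subr0 //.
        exact: leq_trans sp nj.
      rewrite ltnNge; apply/negP => /leq_sizeP/(_ n (leqnn n))/eqP.
      rewrite coefB coefZ subr_eq0 => /eqP e.
      have := @normc_coef_le _ n p f sp; rewrite sf => /(_ (leqnn _) pf).
      have fn : f`_n != 0.
        have : lead_coef f != 0 by rewrite lead_coef_eq0 -size_poly_eq0 sf.
        by rewrite lead_coefE sf.
      by rewrite e normcM leNgt ltr_pMl ?normc_gt0 ?c1.
    move=> x; rewrite rootE hornerD hornerN hornerZ subr_eq0 => /eqP e.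
    rewrite leNgt; apply/negP => x1.
    by have := pf x x1; rewrite e normcM leNgt ltr_pMl ?normc_gt0 ?out ?c1.
  by rewrite horner_Bop_combB /c divfK // subrr eqxx.
(* On the unit circle, approach z along the ray through z. *)
rewrite le_eqVlt => /predU1P[z1|]; last exact: strict.
apply: horner_norm_le_limit => e e0; exists ((1 + e / 2)%:C * z).
  rewrite -[X in _ - X]mul1r -mulrBl -(rmorphB (real_complex R)).
  by rewrite normcM -z1 mulr1 addrC addKr normcC ger0_norm; lra.
by apply: strict; rewrite normcM -z1 mulr1 normcC ger0_norm; lra.
Qed.

(** * The maximum modulus principle for polynomials *)

Lemma prim_root_exists (R : rcfType) n : (0 < n)%N -> exists w : R[i], n.-primitive_root w.
Proof.
move=> n0; pose p : {poly R[i]} := 'X^n - 1.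
have [s ps] := closed_field_poly_normal p.
rewrite (monicP _) ?monicXnsubC // scale1r in ps.
have s1 : all n.-unity_root s by apply/allP => w; rewrite -root_prod_XsubC -ps.
have sz : (n < (size s).+1)%N by rewrite -(size_prod_XsubC s id) -ps size_XnsubC.
have [|w _ prw] := hasP (has_prim_root n0 s1 _ sz); last by exists w.
by rewrite -separable_prod_XsubC -ps separable_Xn_sub_1 // pnatr_eq0 -lt0n.
Qed.

Lemma sum_unity_root (R : rcfType) n (w : R[i]) :
  w ^+ n = 1 -> \sum_(i < n) w ^+ i = if w == 1 then n%:R else 0.
Proof.
move=> wn; case: eqVneq => [->|w1].
  by under eq_bigr do rewrite expr1n; rewrite sumr_const card_ord.
apply/eqP; move/eqP: (subrX1 w n).
by rewrite wn subrr eq_sym mulf_eq0 subr_eq0 (negPf w1).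
Qed.

(** Discrete Fourier inversion: N times the coefficient p_j is the sum of
p(w^i) w^(- i j) over the N-th roots of unity w^i, for N = size p. *)
Lemma normc_coef_circle (R : rcfType) (p : {poly R[i]}) (M : R) j :
  (forall w, normc w = 1 -> normc p.[w] <= M) -> normc p`_j <= M.
Proof.
move=> pM; have [sj|js] := leqP (size p) j.
  rewrite nth_default // Normc.normc0 (le_trans (normc_ge0 _) (pM 1 _)) //.
  exact: Normc.normc1.
set N := size p in js; have N0 : (0 < N)%N by apply: leq_ltn_trans js.
have [w prw] := prim_root_exists R N0; have wN := prim_expr_order prw.
have w1 : normc w = 1.
  by apply/eqP; rewrite -(@pexpr_eq1 _ _ N) ?normc_ge0 // -normcX wN Normc.normc1.
have cst (V : pzRingType) (x : V) : \sum_(i < N) x = N%:R * x.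
  by rewrite sumr_const card_ord mulr_natl.
(* The exponent N - j stands for - j, since w ^+ N = 1. *)
have E : \sum_(i < N) p.[w ^+ i] * w ^+ (i * (N - j)) = N%:R * p`_j.
  under eq_bigr => i _ do rewrite horner_coef mulr_suml.
  rewrite exchange_big /= (bigD1 (Ordinal js)) //= [X in _ + X]big1 => [|m mj].
    rewrite addr0 -cst; apply: eq_bigr => i _.
    rewrite -mulrA -exprM -exprD -mulnDr subnKC 1?ltnW // mulnC exprM wN expr1n.
    by rewrite mulr1.
  under eq_bigr => i _ do
    rewrite -mulrA -exprM -exprD -mulnDr [(i * _)%N]mulnC exprM.
  rewrite -mulr_sumr sum_unity_root; last by rewrite -exprM mulnC exprM wN expr1n.
  rewrite -(prim_order_dvd prw) -/N; case: ifP => [|_]; last by rewrite mulr0.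
  have mN : (m < N)%N := ltn_ord m.
  have mj' : (m != j :> nat) by [].
  rewrite addnBA 1?ltnW // => /dvdnP[[|[|k]] hk]; exfalso; [lia | lia | nia].
have : normc (N%:R * p`_j) <= N%:R * M.
  rewrite -E (le_trans (normc_sum _ _)) // -cst.
  apply: ler_sum => i _; rewrite normcM !normcX w1 expr1n mulr1 pM //.
  by rewrite normcX w1 expr1n.
by rewrite normcM normc_nat ler_pM2l // ltr0n.
Qed.

(** A linear factor cannot make up for an exponential gap: with t = a / M - 1 > 0,
the square of Bernoulli's inequality bounds (1 + t)^(2 m) below by a quadratic
polynomial in m. *)
Lemma le_of_exp_le (R : realType) (a M : R) (d : nat) : 0 <= a -> 0 <= M ->
  (forall k, a ^+ k <= (d * k).+1%:R * M ^+ k) -> a <= M.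
Proof.
move=> a0; rewrite le_eqVlt => /predU1P[<-|M0] h.
  by have := h 1; rewrite !expr1 mulr0.
rewrite leNgt; apply/negP => Ma.
pose t := a / M - 1; have t0 : 0 < t by rewrite subr_gt0 ltr_pdivlMr ?mul1r.
have bern m : 1 + m%:R * t <= (1 + t) ^+ m.
  elim: m => [|m IHm]; first by rewrite mul0r addr0.
  rewrite exprS -natr1; have m0 : 0 <= m%:R :> R := ler0n _ _.
  apply: le_trans (_ : (1 + t) * (1 + m%:R * t) <= _).
    have : 0 <= m%:R * t ^+ 2 by rewrite mulr_ge0 ?sqr_ge0.
    by lra.
  by rewrite ler_pM2l //; lra.
have hk k : (1 + t) ^+ k <= (d * k).+1%:R.
  by rewrite addrC subrK expr_div_n ler_pdivrMr ?exprn_gt0.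
pose m := Num.bound (2 * d%:R / t ^+ 2).
have hm : 2 * d%:R / t ^+ 2 < m%:R.
  by apply: archi_boundP; rewrite divr_ge0 ?mulr_ge0 ?ler0n ?exprn_ge0 ?ltW.
have := hk (m * 2)%N; rewrite exprM leNgt => /negP; apply.
have m0 : 0 <= m%:R :> R := ler0n _ _.
move: hm; rewrite ltr_pdivrMr ?exprn_gt0 // => hm.
apply: (@lt_le_trans _ _ ((1 + m%:R * t) ^+ 2)); last first.
  have b0 : 0 <= 1 + m%:R * t by rewrite addr_ge0 ?mulr_ge0 // ltW.
  by rewrite lerXn2r ?bern // nnegrE ?b0 // (le_trans b0 (bern m)).
rewrite -natr1 !natrM.
have d0 : 0 <= d%:R :> R := ler0n _ _.
have mt : 0 <= m%:R * t by rewrite mulr_ge0 // ltW.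
have [me|mp] := eqVneq (m%:R : R) 0.
  by move: hm; rewrite me mul0r ltNge mulr_ge0.
have : m%:R * (2 * d%:R) < m%:R * (m%:R * t ^+ 2) by rewrite ltr_pM2l // lt_def mp.
by lra.
Qed.

(** Bounding each coefficient by M gives the inequality up to the factor size p.
Applied to p^k, whose size grows linearly in k, it gives the sharp constant
after taking k-th roots. *)
Lemma max_modulus (R : realType) (p : {poly R[i]}) (M : R) z :
  (forall w, normc w = 1 -> normc p.[w] <= M) -> normc z <= 1 -> normc p.[z] <= M.
Proof.
move=> pM z1; have M0 : 0 <= M.
  by apply: le_trans (normc_ge0 _) (pM 1 _); exact: Normc.normc1.
apply: (@le_of_exp_le _ _ _ (size p).-1) => // [|k]; first exact: normc_ge0.
have kM j : normc (p ^+ k)`_j <= M ^+ k.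
  apply: normc_coef_circle => w /pM pw.
  by rewrite horner_exp normcX lerXn2r ?nnegrE ?normc_ge0.
rewrite -normcX -horner_exp (horner_coef_wide _ (size_poly_exp_leq p k)).
rewrite (le_trans (normc_sum _ _)) // mulr_natl.
rewrite -[X in _ *+ X]card_ord -sumr_const.
apply: ler_sum => i _; rewrite normcM -[leRHS]mulr1.
by rewrite ler_pM ?normc_ge0 // normcX exprn_ile1 ?normc_ge0.
Qed.

(** * Polynomials without zeros in the open unit disk *)

Definition disk_free (R : rcfType) (p : {poly R[i]}) : Prop :=
  forall w, normc w < 1 -> ~~ root p w.

(** Multiplying the right-hand side out gives |1 - x^* w|, and
|1 - x^* w|^2 - |x - w|^2 = (|x|^2 - 1) (|w|^2 - 1). *)
Lemma normc_factor_recip (R : rcfType) (x w : R[i]) : 1 <= normc x -> 1 <= normc w ->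
  normc (x - w) <= normc x * normc ((conjc x)^-1 - w).
Proof.
move=> x1 w1; have x0 : conjc x != 0.
  by rewrite conjc_eq0 -normc_gt0; lra.
rewrite -[normc x]normc_conj -normcM mulrBr mulfV // ler_normc_sqr.
have : 0 <= (normc x ^+ 2 - 1) * (normc w ^+ 2 - 1).
  by rewrite mulr_ge0 // subr_ge0 expr_ge1 ?normc_ge0.
rewrite !sqr_normcE; case: x w {x0 x1 w1} => a b [c d] /=.
by lra.
Qed.

Lemma normc_le_recip (R : rcfType) n (p : {poly R[i]}) x :
  size p = n.+1 -> disk_free p -> 1 <= normc x -> normc p.[x] <= normc (recip n p).[x].
Proof.
move=> sp pF x1; have x0 : x != 0 by rewrite -normc_gt0; lra.
have [s ps] := closed_field_poly_normal p.
have sn := size_factor sp ps.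
have c0 : lead_coef p != 0 by rewrite lead_coef_eq0 -size_poly_eq0 sp.
have sF : {in s, forall w, 1 <= normc w}.
  move=> w ws; rewrite leNgt; apply/negP => /pF.
  by rewrite ps rootZ // root_prod_XsubC ws.
rewrite horner_recip ?sp // normcM normc_conj normcX -sn ps !hornerZ !normcM mulrCA.
rewrite ler_pM2l ?normc_gt0 // !horner_prod !normc_prod.
have -> : normc x ^+ size s = \prod_(w <- s) normc x.
  by rewrite big_const_seq count_predT iter_mulr_1.
rewrite -big_split /= big_seq [leRHS]big_seq; apply: ler_prod => w ws.
by rewrite !hornerXsubC normc_ge0 normc_factor_recip // sF.
Qed.

Lemma recip_disk_roots (R : rcfType) n (p : {poly R[i]}) :
  size p = n.+1 -> disk_free p ->
  size (recip n p) = n.+1 /\ disk_roots (recip n p).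
Proof.
move=> sp pF; have p0 : p`_0 != 0.
  by have := pF 0; rewrite Normc.normc0 rootE horner_coef0 => ->.
split; first by rewrite size_poly_eq // subnn conjc_eq0.
move=> x; rewrite rootE leNgt => rx; apply/negP => x1.
have x0 : x != 0 by rewrite -normc_gt0; lra.
move: rx; rewrite horner_recip ?sp // mulf_eq0 expf_eq0 (negPf x0) andbF /= conjc_eq0.
apply/negP/pF; rewrite Normc.normcV normc_conj invf_lt1 //; lra.
Qed.

Lemma Bop_comb_recip (R : realType) n (lam0 lam1 lam2 : R[i]) (r : R) (g : R[i])
    (p : {poly R[i]}) z :
  (0 < n)%N -> half_plane_zeros n (horner (upoly n lam0 lam1 lam2)) ->
  1 <= r -> normc g <= ((r + 1) / 2) ^+ n -> (r ^+ n)%:C + g != 0 ->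
  size p = n.+1 -> disk_free p -> 1 <= normc z ->
  normc (Bop_comb n lam0 lam1 lam2 r g p).[z] <=
  normc (Bop_comb n lam0 lam1 lam2 r g (recip n p)).[z].
Proof.
move=> n0 hu r1 gK g0 sp pF z1; have [sq qD] := recip_disk_roots sp pF.
apply: Bop_comb_comparison; rewrite ?sp // => x /ltW x1.
exact: normc_le_recip.
Qed.

(** Apply the comparison of p with its reversal to p - c, where |c| = N is slightly
larger than M; the reversal of p - c is recip p - c^* z^n, and the argument of c
is free. *)
Lemma Bop_comb_recip_sum (R : realType) n (lam0 lam1 lam2 : R[i]) (r : R) (g : R[i])
    (p : {poly R[i]}) (M : R) z :
  (0 < n)%N -> half_plane_zeros n (horner (upoly n lam0 lam1 lam2)) ->
  1 <= r -> normc g <= ((r + 1) / 2) ^+ n -> (r ^+ n)%:C + g != 0 ->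
  size p = n.+1 -> disk_free p -> (forall w, normc w = 1 -> normc p.[w] <= M) ->
  1 <= normc z ->
  normc (Bop_comb n lam0 lam1 lam2 r g p).[z] +
  normc (Bop_comb n lam0 lam1 lam2 r g (recip n p)).[z] <=
  M * (normc (Bop_comb n lam0 lam1 lam2 r g 'X^n).[z] +
       normc (Bop_comb n lam0 lam1 lam2 r g 1).[z]).
Proof.
move=> n0 hu r1 gK g0 sp pF pM z1.
have M0 : 0 <= M by apply: le_trans (normc_ge0 _) (pM 1 _); exact: Normc.normc1.
set a := (Bop_comb n lam0 lam1 lam2 r g (recip n p)).[z].
set b := (Bop_comb n lam0 lam1 lam2 r g 'X^n).[z].
set d := (Bop_comb n lam0 lam1 lam2 r g 1).[z].
suff main (N : R) : M < N ->
    normc (Bop_comb n lam0 lam1 lam2 r g p).[z] + normc a <= N * (normc b + normc d).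
  have s0 : 0 < normc b + normc d + 1 by rewrite ltr_wpDl ?addr_ge0 ?normc_ge0.
  apply/ler_addgt0Pr => e e0.
  have := main (M + e / (normc b + normc d + 1)); rewrite ltrDl divr_gt0 //.
  move=> /(_ isT) /le_trans; apply; rewrite mulrDl lerD2l mulrAC ler_pdivrMr //.
  by rewrite ler_pM2l //; lra.
move=> MN; have N0 : 0 < N by lra.
(* Outside the disk |recip p| <= M |x|^n, by the maximum modulus principle. *)
have ab : normc a <= N * normc b.
  have -> : N * normc b = normc (N%:C * b) by rewrite normcM normcC gtr0_norm.
  rewrite -horner_Bop_combZ.
  have NC : N%:C != 0 :> R[i] by rewrite fmorph_eq0 gt_eqF.
  apply: Bop_comb_comparison => //; rewrite ?size_scale ?size_polyXn ?size_poly //.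
    move=> w; rewrite rootE hornerZ hornerXn mulf_eq0 (negPf NC) /= expf_eq0 => /andP[_ /eqP->].
    by rewrite Normc.normc0.
  move=> x x1; have x0 : x != 0 by rewrite -normc_gt0; lra.
  rewrite horner_recip ?sp // hornerZ hornerXn !normcM mulrC ler_wpM2r ?normc_ge0 //.
  rewrite normc_conj normcC gtr0_norm // (le_trans _ (ltW MN)) //.
  by apply: max_modulus => //; rewrite Normc.normcV normc_conj invf_le1; lra.
(* With this c, the modulus of a - c^* b is N |b| - |a|. *)
have [v v1 hv] := unit_align a b.
pose c := conjc v * N%:C.
have nc : normc c = N by rewrite normcM normc_conj v1 mul1r normcC gtr0_norm.
pose f := p - c *: 1.
have sf : size f = n.+1.
  rewrite /f size_addl ?sp // size_opp (leq_ltn_trans (size_scale_leq _ _)) //.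
  by rewrite size_poly1.
have fF : disk_free f.
  move=> w w1; rewrite rootE /f hornerD hornerN hornerZ hornerC mulr1 subr_eq0.
  apply/eqP => e; have := max_modulus pM (ltW w1).
  by rewrite e nc leNgt MN.
have := Bop_comb_recip n0 hu r1 gK g0 sf fF z1.
rewrite /f recip_subC !horner_Bop_combB -/a -/b -/d.
have -> : a - conjc c * b = a + (- N)%:C * (v * b).
  have -> : conjc c = v * N%:C.
    by rewrite /c [LHS]rmorphM; congr (_ * _); [exact: conjcK | exact: conjc_real].
  by rewrite rmorphN; ring.
rewrite hv mulNr ler0_norm ?subr_le0 // => h.
have := normc_triB (Bop_comb n lam0 lam1 lam2 r g p).[z] (c * d).
rewrite normcM nc; lra.
Qed.

(** * The constant gamma and the maximum on the unit circle *)

(** |gamma| <= |alpha| + (K - |alpha|) = K, because K >= 1 >= |alpha|. *)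
Lemma beta_term_bound (R : realType) n (alpha beta : R[i]) (r : R) :
  normc alpha <= 1 -> normc beta <= 1 -> 1 <= r ->
  normc (- alpha + beta_term n alpha beta r) <= ((r + 1) / 2) ^+ n.
Proof.
move=> a1 b1 r1; have K1 : 1 <= ((r + 1) / 2) ^+ n by rewrite exprn_ege1 //; lra.
rewrite (le_trans (normc_tri _ _)) // normcN /beta_term normcM.
have -> : `|alpha| = (normc alpha)%:C by [].
rewrite -(rmorphB (real_complex R)) normcC ger0_norm; last by rewrite subr_ge0 (le_trans a1).
have := normc_ge0 alpha; nra.
Qed.

Lemma circle_bounded (R : realType) (p : {poly R[i]}) :
  has_sup [set normc p.[w] | w in [set w : R[i] | `|w| = 1]]%classic.
Proof.
split; first by exists (normc p.[1]), 1 => //=; exact: normr1.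
have [C C0 hC] := horner_lipschitz p (@ler01 R).
exists C => _ [w /= w1 <-].
have {}w1 : normc w = 1 by apply: complexI.
by have [] := hC w w; rewrite ?w1.
Qed.

Lemma le_max_circle (R : realType) (p : {poly R[i]}) w :
  normc w = 1 -> normc p.[w] <= max_circle p.
Proof.
move=> w1; apply: sup_upper_bound; first exact: circle_bounded.
by exists w => //=; rewrite -[LHS]/((normc w)%:C) w1.
Qed.

Lemma max_circle_Xn_add1 (R : realType) n : max_circle ('X^n + 1 : {poly R[i]}) = 2.
Proof.
apply/eqP; rewrite eq_le; apply/andP; split; last first.
  have := @le_max_circle R ('X^n + 1) 1 (Normc.normc1 R).
  by rewrite !hornerE expr1n -(natrD _ 1 1) normc_nat.
apply: ge_sup => [|_ [w /= w1 <-]]; first exact: (circle_bounded _).1.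
have {}w1 : normc w = 1 by apply: complexI.
rewrite !hornerE (le_trans (normc_tri _ _)) // normcX w1 expr1n.
by rewrite [X in _ + X]Normc.normc1.
Qed.

(** * The inequality and its sharpness *)

(* Inequalities between moduli are in R[i], whose order restricted to real
   elements is that of R. *)
Theorem theorem3 (R : realType) (n : nat) (lam0 lam1 lam2 : R[i])
    (n_ge1 : (1 <= n)%N)
    (u_zeros : forall z : R[i], root (upoly n lam0 lam1 lam2) z ->
       `|z| <= `|z - n%:R / 2|) :
  let B := Bop n lam0 lam1 lam2 in
  (forall P : {poly R[i]}, size P = n.+1 ->
    (forall z : R[i], `|z| < 1 -> ~~ root P z) ->
    forall (alpha beta : R[i]), `|alpha| <= 1 -> `|beta| <= 1 ->
    forall r : R, 1 <= r ->
    forall z : R[i], 1 <= `|z| ->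
      `| (B (dilate r P)).[z] - alpha * (B P).[z]
         + beta_term n alpha beta r * (B P).[z] |
      <= 2^-1 * ( `| (r ^+ n)%:C - alpha + beta_term n alpha beta r |
                    * `| (B 'X^n).[z] |
                  + `| 1 - alpha + beta_term n alpha beta r | * `|lam0| )
         * (max_circle P)%:C)
  /\
  (forall (alpha beta : R[i]), `|alpha| <= 1 -> `|beta| <= 1 ->
    forall r : R, 1 <= r ->
    exists z : R[i], 1 <= `|z| /\
      let P : {poly R[i]} := 'X^n + 1 in
      `| (B (dilate r P)).[z] - alpha * (B P).[z]
         + beta_term n alpha beta r * (B P).[z] |
      = 2^-1 * ( `| (r ^+ n)%:C - alpha + beta_term n alpha beta r |
                    * `| (B 'X^n).[z] |
                  + `| 1 - alpha + beta_term n alpha beta r | * `|lam0| )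
         * (max_circle P)%:C).
Proof.
move=> B.
have normE (x : R[i]) : `|x| = (normc x)%:C by [].
have ge1 (x : R[i]) : (1 <= `|x|) = (1 <= normc x) by rewrite -lecR.
have le1 (x : R[i]) : (`|x| <= 1) = (normc x <= 1) by rewrite -lecR.
have lt1 (x : R[i]) : (`|x| < 1) = (normc x < 1) by rewrite -ltcR.
have half : (2^-1 : R[i]) = (2^-1 : R)%:C by rewrite fmorphV rmorph_nat.
have hu : half_plane_zeros n (horner (upoly n lam0 lam1 lam2)).
  by move=> y /eqP/u_zeros; rewrite !normE lecR.
have LE alpha beta r p z : (B (dilate r p)).[z] - alpha * (B p).[z]
    + beta_term n alpha beta r * (B p).[z] =
    (Bop_comb n lam0 lam1 lam2 r (- alpha + beta_term n alpha beta r) p).[z].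
  by rewrite horner_Bop_comb -/B mulrDl mulNr addrA.
have rhsE (alpha beta : R[i]) r z M :
    2^-1 * ( `| (r ^+ n)%:C - alpha + beta_term n alpha beta r | * `| (B 'X^n).[z] |
             + `| 1 - alpha + beta_term n alpha beta r | * `|lam0| ) * M%:C =
    (2^-1 * (normc (Bop_comb n lam0 lam1 lam2 r (- alpha + beta_term n alpha beta r) 'X^n).[z]
       + normc (Bop_comb n lam0 lam1 lam2 r (- alpha + beta_term n alpha beta r) 1).[z]) * M)%:C.
  rewrite horner_Bop_comb_Xn -(expr0 'X) horner_Bop_comb_Xn !expr0 Bop_1 !normcM -!addrA.
  by rewrite !rmorphM rmorphD !rmorphM half.
split=> [P sP PF alpha beta | alpha beta]; rewrite !le1 => a1 b1 r r1.
  move=> z; rewrite ge1 LE normE rhsE lecR => z1.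
  have := beta_term_bound n a1 b1 r1; set g := - alpha + _ => gK.
  have PF' : disk_free P by move=> w w1; apply: PF; rewrite lt1.
  have PM w : normc w = 1 -> normc P.[w] <= max_circle P by exact: le_max_circle.
  have M0 : 0 <= max_circle P.
    by apply: le_trans (normc_ge0 _) (PM 1 _); exact: Normc.normc1.
  have [g0|g0] := eqVneq ((r ^+ n)%:C + g) 0; last first.
    have h1 := Bop_comb_recip n_ge1 hu r1 gK g0 sP PF' z1.
    have h2 := Bop_comb_recip_sum n_ge1 hu r1 gK g0 sP PF' PM z1.
    move: h1 h2; rewrite -/g; lra.
  (* r^n = |g| <= ((r + 1) / 2)^n leaves only r = 1, g = - 1, where L = 0. *)
  have r1' : r = 1.
    apply/eqP; rewrite eq_le r1 andbT.
    have : r ^+ n <= ((r + 1) / 2) ^+ n.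
      have : normc g = r ^+ n.
        have -> : g = - (r ^+ n)%:C by apply/eqP; rewrite -addr_eq0 addrC g0.
        by rewrite normcN normcC ger0_norm // exprn_ge0 //; lra.
      by move=> <-.
    by rewrite ler_pXn2r // ?nnegrE; lra.
  have -> : (Bop_comb n lam0 lam1 lam2 r g P).[z] = 0.
    rewrite /Bop_comb; suff -> : dilate_comb r g P = 0 *: P by rewrite horner_BopZ mul0r.
    move: g0; rewrite r1' expr1n => g0.
    by apply/polyP => i; rewrite coef_dilate_comb coefZ expr1n g0.
  by rewrite Normc.normc0 !mulr_ge0 ?invr_ge0 ?addr_ge0 ?normc_ge0.
pose g := - alpha + beta_term n alpha beta r; have [c cE] := Bop_Xn n lam0 lam1 lam2 n.
(* On the circle choose z^n so that the two terms of L[z^n + 1] are aligned. *)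
have [v v1 hv] := unit_align ((1 + g) * lam0) (((r ^+ n)%:C + g) * c).
have [z zn] : exists z : R[i], z ^+ n = v by exists (n.-root v); rewrite rootCK.
have z1 : normc z = 1.
  by apply/eqP; rewrite -(@pexpr_eq1 _ _ n) ?normc_ge0 // -normcX zn v1.
exists z; rewrite ge1 z1; split=> // P; rewrite {}/P.
rewrite normE LE rhsE max_circle_Xn_add1 -/g; congr (_%:C).
have -> : 'X^n + 1 = 'X^n - (-1) *: (1 : {poly R[i]}) by rewrite scaleN1r opprK.
rewrite horner_Bop_combB -(expr0 'X) !horner_Bop_comb_Xn !expr0 Bop_1 cE zn mulN1r opprK.
have := hv 1; rewrite rmorph1 !mul1r addrC => hv1.
have -> : ((r ^+ n)%:C + g) * (c * v) + (1 + g) * lam0 =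
   v * (((r ^+ n)%:C + g) * c) + (1 + g) * lam0 by ring.
rewrite hv1 ger0_norm ?addr_ge0 ?normc_ge0 // !normcM v1.
by field.
Qed.
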